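(* Let $g\colon\mathbb{R}_{\ge 0}\to\mathbb{R}_{\ge 0}$ be a strictly increasing super-additive function, let $c\le 1/2$ be a real number, and let $\delta_1,\delta_2,\delta_3,\ldots\ge 1$ be integers such that $$(1-c)\cdot g(2^n)<(\delta_1+1)\cdots(\delta_n+1)<(1+c)\cdot g(2^n)\qquad\text{for all } n\ge 0.$$ Let $T=T(\delta_1,\delta_2,\ldots)$ be a limit tree of the sequence, and for $n\ge 1$ set $\Delta(n):=\dfrac{\delta_n}{\delta_1\cdots\delta_{n-1}}$. Fix $v\in V(T)$ and $r\ge 0$. Then: (i) $|B_T(v,r)|\ge(1-c)\cdot g(r/4)\ge\tfrac12\,g(r/4)$. (ii) If $\bar\Delta:=\sup_n\lceil\Delta(n)\rceil+1<\infty$, then $T$ is of maximum degree $\bar\Delta$ and $$|B_T(v,r)|\le 2\bar\Delta\cdot(1+c)^2\cdot g(2r)^2\le\tfrac92\bar\Delta\cdot g(2r)^2 .$$ (iii) If $\Gamma:=\sup_{m\ge n}\lceil\Delta(m)/\Delta(n)\rceil<\infty$, then $\bar\Delta<\infty$ and $$|B_T(v,r)|\le 2(1+c)\cdot\big(\Gamma\cdot g(4r)-(\Gamma-1)\cdot g(2r)\big)\le 3\big(\Gamma\cdot g(4r)-(\Gamma-1)\cdot g(2r)\big)\le 3\Gamma\cdot g(4r).$$ In particular, if $\Gamma<\infty$ then $T$ is of uniform volume growth $g$, i.e. there are constants $c_1,C_1,c_2,C_2>0$ such that $C_1g(c_1r)\le|B_T(v,r)|\le C_2g(c_2r)$ for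 all $r\ge 0$ and all $v\in V(T)$.
   Context: $\lceil\cdot\rceil$ is the ceiling; empty products equal $1$. $B_T(v,r)$ is the set of vertices of $T$ at graph distance at most $r$ from $v$, $r$ real. $g$ is super-additive if $g(r_1+r_2)\ge g(r_1)+g(r_2)$ for all $r_1,r_2\ge 0$. Construction of $T_n$. Let $\delta_1,\delta_2,\ldots\ge 1$ be integers. The finite trees $T_n$, $n\ge 0$, each with a distinguished center and a distinguished set of apocentric vertices, are defined recursively. $T_0$ is a single vertex, which is both its center and its only apocentric vertex. For $n\ge1$, $T_n$ is built from $\delta_n+1$ disjoint copies $\tau_0,\tau_1,\ldots,\tau_{\delta_n}$ of $T_{n-1}$ by adding, for each $i\in\{1,\ldots,\delta_n\}$, one edge between the center of $\tau_i$ and some apocentric vertex of $\tau_0$ (the same apocentric vertex of $\tau_0$ may be used several times), subject to the maximal uniformity condition below. The center of $T_n$ is the center of $\tau_0$; the apocentric vertices of $T_n$ are the apocentric vertices of $\tau_1,\ldots,\tau_{\delta_n}$. Canonical copies. $T_n$ is the only canonical copy of $T_n$ in itself; for $m<n$ the canonical copies of $T_m$ in $T_n$ are the canonical copies of $T_m$ in $\tau_0,\ldots,\tau_{\delta_n}$. Write $\tau\prec_m T_n$ if $\tau$ is a canonical copy of $T_m$ in $T_n$ (and likewise for trees isomorphic to $T_n$). Such a copy is apocentric if it contains apocentric vertices of $T_n$. Maximal uniformity. In forming $T_n$, for every $m\le n-1$ and every apocentric $\tau\prec_m\tau_0$, the number $E_\tau$ of the $\delta_n$ new edges that have an end in $\tau$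 satisfies $$\Big\lfloor\frac{\delta_1\cdots\delta_m}{\delta_1\cdots\delta_{n-1}}\,\delta_n\Big\rfloor\le E_\tau\le\Big\lceil\frac{\delta_1\cdots\delta_m}{\delta_1\cdots\delta_{n-1}}\,\delta_n\Big\rceil .$$ Limit trees. For each $n$ identify $T_n$ with one of its copies $\tau_0,\ldots,\tau_{\delta_{n+1}}$ in $T_{n+1}$ (any choice); this gives an inclusion chain $T_0\subset T_1\subset T_2\subset\cdots$, and $T=T(\delta_1,\delta_2,\ldots):=\bigcup_n T_n$ is a limit tree.
   Formalization: The upper bounds on |B_T(v,r)| are proved only for r ≥ 1/2 in (ii), r ≥ 1/4 in (iii) and r ≥ 1 in uniform volume growth, since super-additivity forces g(0)=0 while |B_T(v,0)|=1, so they fail as printed near r = 0. *)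

(* Defs.v *)
From HB Require Import structures.
From mathcomp Require Import all_boot all_order all_algebra.
From mathcomp Require Import all_classical all_reals all_analysis.

Set Implicit Arguments.
Unset Strict Implicit.
Unset Printing Implicit Defensive.

Import Order.TTheory GRing.Theory Num.Theory.

Local Open Scope ring_scope.

(* The sequence delta_1, delta_2, ... is a function delta : nat -> nat whose
   value at 0 is never used. *)

(* T_n.+1 consists of delta_n.+1 + 1 disjoint copies of T_n: the vertex (i, x)
   is the vertex x of the i-th copy tau_i. *)
Fixpoint tvert (delta : nat -> nat) (n : nat) : finType :=
  if n is k.+1 then ('I_(delta k.+1).+1 * tvert delta k)%type else unit.

Fixpoint tcenter (delta : nat -> nat) (n : nat) : tvert delta n :=
  if n is k.+1 then (ord0, tcenter delta k) else tt.

Fixpoint apocentric (delta : nat -> nat) (n : nat) : pred (tvert delta n) :=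
  if n is k.+1 then fun x => (x.1 != ord0) && apocentric x.2 else fun=> true.

(* Canonical copies of T_m in T_n, given by their vertex sets; the set is
   empty for m > n. *)
Fixpoint canonical_copies (delta : nat -> nat) (m n : nat) :
    {set {set tvert delta n}} :=
  if m == n then [set [set: tvert delta n]]
  else if n is k.+1 then
    \bigcup_(i < (delta k.+1).+1)
      [set [set ((i, x) : tvert delta k.+1) | x in A]
         | A : {set tvert delta k} in canonical_copies delta m k]
  else finset.set0.

Definition apocentric_set (delta : nat -> nat) (n : nat)
    (A : {set tvert delta n}) : Prop :=
  exists2 x, x \in A & apocentric x.

(* All choices made in forming T_1, T_2, ...  In T_n.+1 the center of tau_j.+1
   (j < delta_n.+1) is joined to the vertex [attach n j] of tau_0; the number
   of new edges with an end in a subset A of tau_0 is thus the number of j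
   with [attach n j] in A. *)
Record tree_construction (delta : nat -> nat) := TreeConstruction {
  attach : forall n, 'I_(delta n.+1) -> tvert delta n;
  attach_apocentric : forall n j, apocentric (@attach n j);
  attach_uniform : forall n m (A : {set tvert delta n}),
    (m <= n)%N -> A \in canonical_copies delta m n -> apocentric_set A ->
    let q : rat := (\prod_(1 <= k < m.+1) (delta k)%:R)
                   / (\prod_(1 <= k < n.+1) (delta k)%:R)
                   * (delta n.+1)%:R in
    let E := #|[set j | @attach n j \in A]| in
    Num.floor q <= E%:Z <= Num.ceil q
}.

Section TreeEdges.
Variables (delta : nat -> nat) (C : tree_construction delta).

Definition new_edge (n : nat) (x y : tvert delta n.+1) : bool :=
  [exists j : 'I_(delta n.+1),
     (x == (lift ord0 j, tcenter delta n)) && (y == (ord0, @attach delta C n j))].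

Fixpoint tedge (n : nat) : rel (tvert delta n) :=
  if n is k.+1 then
    fun x y => [|| (x.1 == y.1) && tedge x.2 y.2, new_edge x y | new_edge y x]
  else fun _ _ => false.

End TreeEdges.

(* The graph (V, adj) is the union of a chain T_0 c T_1 c T_2 c ...;
   [emb n] is the inclusion of T_n, and T_n is identified with the copy
   tau_(emb_index n) in T_n.+1. *)
Record limit_tree (delta : nat -> nat) (C : tree_construction delta)
    (V : Type) (adj : rel V) := LimitTree {
  emb_index : forall n, 'I_(delta n.+1).+1;
  emb : forall n, tvert delta n -> V;
  emb_inj : forall n, injective (@emb n);
  emb_chain : forall n (x : tvert delta n),
    emb x = @emb n.+1 (emb_index n, x);
  emb_cover : forall v, exists n (x : tvert delta n), v = emb x;
  emb_adj : forall u v, adj u v <->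
    exists n (x y : tvert delta n), [/\ u = emb x, v = emb y & tedge C x y]
}.

Section Graphs.
Variables (R : realType) (V : choiceType) (adj : rel V).
Local Open Scope classical_set_scope.

(* Infimum of the lengths of the walks from u to v (+oo if there is none). *)
Definition gdist (u v : V) : \bar R :=
  ereal_inf [set ((size p)%:R)%:E | p in
               [set p : seq V | path adj u p /\ last u p = v]].

Definition gball (v : V) (r : R) : set V :=
  [set w | (gdist v w <= r%:E)%E].

(* [counting] is the cardinality, with value +oo on infinite sets. *)
Definition ball_size (v : V) (r : R) : \bar R := counting (gball v r).

Definition degree (v : V) : \bar R := counting [set w | adj v w].

Definition is_max_degree (D : \bar R) : Prop :=
  (forall v, (degree v <= D)%E) /\ (exists v, degree v = D).

(* The upper bound is required for r >= 1 only: a super-additive g satisfies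
   g 0 = 0 (and g r -> 0 as r -> 0), so no bound |B(v,r)| <= C2 * g (c2 * r)
   can hold near r = 0, where |B(v,r)| = 1. *)
Definition uniform_growth (g : R -> R) : Prop :=
  exists c1 C1 c2 C2 : R,
    [/\ 0 < c1, 0 < C1, 0 < c2, 0 < C2 &
    forall (v : V) (r : R), 0 <= r ->
      ((C1 * g (c1 * r))%:E <= ball_size v r)%E /\
      (1 <= r -> (ball_size v r <= (C2 * g (c2 * r))%:E)%E)].

End Graphs.

(* Meaningful for n >= 1. *)
Definition Delta (delta : nat -> nat) (n : nat) : rat :=
  (delta n)%:R / \prod_(1 <= k < n) (delta k)%:R.

Section Sup.
Variables (R : realType) (delta : nat -> nat).
Local Open Scope classical_set_scope.

Definition Delta_bar : \bar R :=
  (ereal_sup [set ((Num.ceil (Delta delta n))%:~R)%:E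
                | n in [set n | (1 <= n)%N]] + 1)%E.

(* The supremum is over all pairs of indices 1 <= n <= m. *)
Definition Gamma : \bar R :=
  ereal_sup [set ((Num.ceil (Delta delta p.1 / Delta delta p.2))%:~R)%:E
               | p in [set p : nat * nat | (1 <= p.2)%N /\ (p.2 <= p.1)%N]].

End Sup.

(* Main.v *)
Require Import Defs.
From mathcomp Require Import all_boot all_order all_algebra.
From mathcomp Require Import all_classical all_reals all_analysis.
From mathcomp Require Import zify ring lra.

Import Order.TTheory GRing.Theory Num.Theory.
Local Open Scope ring_scope.

(* Let phi r be the number of vertices of T_n at distance less than r from the
   center. Every copy of T_n is crossed from its center to an apocentric vertex
   in exactly 2 ^ n - 1 steps, so a ball of radius less than 2 ^ n meets only
   the copy of T_n that contains its center v, the parent copy, the child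
   copies and the sibling copies. If v has height h in its copy, then each child
   contributes at most phi h vertices and each sibling at most
   phi (2 ^ n - 2 - h), and the self-similarity of T_n yields
   phi a + phi b <= |T_n| whenever a + b <= 2 ^ n. Hence the ball has at most
   (M + 2) |T_n| vertices, M being a bound on the number of children of a copy.
   Maximal uniformity gives M = delta_1 ... delta_n (Delta_bar - 1) for (ii) and
   M = Gamma delta_n+1 for (iii). In (iii) super-additivity enters through
   Gamma g(4r) - (Gamma - 1) g(2r) >= (Gamma + 1) g(4r) / 2, which dominates
   (Gamma + 1) |T_n+1| / (2 (1 + c)). *)

(** * Heights and distances in the finite trees *)

Section FiniteTrees.
Local Open Scope nat_scope.
Variables (delta : nat -> nat) (C : tree_construction delta).
Local Notation tvert := (tvert delta).
Local Notation att := (@attach delta C _).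

(** This is the distance to the center, see [dist_center]: a copy tau_i with i > 0 hangs one edge
    beyond an apocentric vertex of tau_0, whose height is 2^k - 1. *)
Fixpoint height n : tvert n -> nat :=
  if n is k.+1 then fun x => (x.1 != ord0) * 2 ^ k + height k x.2 else fun=> 0.
Arguments height {n}.

(** The tree metric in closed form: a path between distinct copies enters or leaves tau_i, i > 0,
    through its center and runs through tau_0 from or to the attachment vertices. [dist_walk]
    compares it with walks. *)
Fixpoint dist n : tvert n -> tvert n -> nat :=
  if n is k.+1 then fun x y =>
    match unlift ord0 x.1, unlift ord0 y.1 with
    | None, None => dist k x.2 y.2
    | None, Some j => (dist k x.2 (att j) + height y.2).+1
    | Some i, None => (height x.2 + dist k (att i) y.2).+1
    | Some i, Some j => if i == j then dist k x.2 y.2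
                        else (height x.2 + dist k (att i) (att j) + height y.2).+2
    end
  else fun _ _ => 0.
Arguments dist {n}.

Lemma tvertS_ind n (P : tvert n.+1 -> Prop) :
    (forall x : tvert n, P (ord0, x)) ->
    (forall i (x : tvert n), P (lift ord0 i, x)) ->
  forall x, P x.
Proof. by move=> P0 PS [i x]; case: (unliftP ord0 i) => [j|] ->. Qed.

Section Step.
Variable n : nat.
Implicit Types (x y : tvert n) (i j : 'I_(delta n.+1)).

Lemma height0 x : height ((ord0, x) : tvert n.+1) = height x.
Proof. by []. Qed.

Lemma heightS i x : height ((lift ord0 i, x) : tvert n.+1) = 2 ^ n + height x.
Proof. by rewrite /= mul1n. Qed.

Lemma dist00 x y : dist ((ord0, x) : tvert n.+1) (ord0, y) = dist x y.
Proof. by rewrite /= !unlift_none. Qed.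

Lemma dist0S x j y :
  dist ((ord0, x) : tvert n.+1) (lift ord0 j, y) = (dist x (att j) + height y).+1.
Proof. by rewrite /= unlift_none liftK. Qed.

Lemma distS0 i x y :
  dist ((lift ord0 i, x) : tvert n.+1) (ord0, y) = (height x + dist (att i) y).+1.
Proof. by rewrite /= unlift_none liftK. Qed.

Lemma distSS i x j y : i != j ->
  dist ((lift ord0 i, x) : tvert n.+1) (lift ord0 j, y)
    = (height x + dist (att i) (att j) + height y).+2.
Proof. by rewrite /= !liftK => /negPf->. Qed.

Lemma dist_copy (i : 'I_(delta n.+1).+1) x y :
  dist ((i, x) : tvert n.+1) (i, y) = dist x y.
Proof. by rewrite /=; case: unliftP => // j _; rewrite eqxx. Qed.

End Step.

Lemma height_center n : height (tcenter delta n) = 0.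
Proof. by elim: n => //= n ->. Qed.

Lemma height_apocentric n (x : tvert n) : apocentric x -> (height x).+1 = 2 ^ n.
Proof.
elim: n x => [|n IHn] [] //= i x /andP[/= -> /IHn]; rewrite expnS; lia.
Qed.

Lemma height_lt n (x : tvert n) : height x < 2 ^ n.
Proof.
elim: n x => [|n IHn] [] // i x /=; have := IHn x; rewrite expnS; lia.
Qed.

Lemma distxx n (x : tvert n) : dist x x = 0.
Proof. by elim: n x => [|n IHn] [] // i x; rewrite dist_copy. Qed.

Lemma dist_center n (x : tvert n) : dist x (tcenter delta n) = height x.
Proof.
elim: n x => [|n IHn] // [i x] /=; case: (unliftP ord0 i) => [j|] -> /=.
  by rewrite unlift_none IHn -addnS height_apocentric ?attach_apocentric //= mul1n addnC.
by rewrite unlift_none IHn.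
Qed.

(** Triangle inequality through the center. For apocentric [y] it puts [x] at distance at least 2^n
    - 1 - [height x] from [y]. *)
Lemma height_le_dist n (x y : tvert n) : height y <= height x + dist x y.
Proof.
elim: n x y => [|n IHn] // [i x] [j y].
case: (unliftP ord0 i) => [k|] ->; case: (unliftP ord0 j) => [l|] ->.
- have [->|kl] := eqVneq k l; first by rewrite dist_copy !heightS -addnA leq_add2l.
  rewrite distSS // !heightS; lia.
- have := height_apocentric _ _ (attach_apocentric C k).
  have := IHn (att k) y; rewrite distS0 heightS height0; lia.
- have := height_apocentric _ _ (attach_apocentric C l).
  have := IHn x (att l); rewrite dist0S heightS height0; lia.
- by rewrite dist00 !height0.
Qed.

(** * Edges and their effect on heights and distances *)

Lemma new_edgeP n (x y : tvert n.+1) :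
  reflect (exists2 j, x = (lift ord0 j, tcenter delta n) & y = (ord0, att j))
    (new_edge C x y).
Proof.
apply: (iffP existsP) => -[j]; first by case/andP=> /eqP-> /eqP->; exists j.
by move=> -> ->; exists j; rewrite !eqxx.
Qed.

Lemma tedge_copy n i (x y : tvert n) :
  tedge C ((i, x) : tvert n.+1) (i, y) = tedge C x y.
Proof.
rewrite -[LHS]/([|| (i == i) && _, _ | _]) eqxx; apply: orb_idr.
by case/orP=> /new_edgeP[j [->] ].
Qed.

Lemma tedge_0S n j (x y : tvert n) :
  tedge C ((ord0, x) : tvert n.+1) (lift ord0 j, y)
    = (att j == x) && (y == tcenter delta n).
Proof.
apply/or3P/andP => [[//|/new_edgeP[l []//]|/existsP[l]]|[/eqP<- /eqP->]].
  by case/andP; rewrite !xpair_eqE (inj_eq lift_inj) => /andP[/eqP-> ->]; rewrite eq_sym.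
by apply: Or33; apply/new_edgeP; exists j.
Qed.

Lemma tedge_SS n i j (x y : tvert n) : i != j ->
  tedge C ((lift ord0 i, x) : tvert n.+1) (lift ord0 j, y) = false.
Proof.
move=> ij; apply/negP => /or3P[/andP[/= ]||]; last 2 first.
- by case/new_edgeP=> l _ [].
- by case/new_edgeP=> l _ [].
by rewrite (inj_eq lift_inj) (negPf ij).
Qed.

Lemma tedge_sym n (x y : tvert n) : tedge C x y = tedge C y x.
Proof. by elim: n x y => //= n IHn x y; rewrite eq_sym IHn [X in _ || X]orbC. Qed.

Lemma height_edge n (x y : tvert n) : tedge C x y -> height y <= (height x).+1.
Proof.
elim: n x y => //= n IHn [i x] [k y] /=.
case/or3P=> [/andP[/eqP-> /IHn]|/new_edgeP[j [-> ->] [-> ->]]|/new_edgeP[j [-> ->] [-> ->]]].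
- lia.
- have := height_apocentric _ _ (attach_apocentric C j); rewrite /=; lia.
- have := height_apocentric _ _ (attach_apocentric C j).
  rewrite /= height_center; lia.
Qed.

Lemma dist_edge n (x y z : tvert n) : tedge C y z -> dist x z <= (dist x y).+1.
Proof.
elim: n x y z => // n IHn [i x] [k y] [l z].
case/or3P=> [/andP[kl yz]||].
- have {}kl : k = l := eqP kl.
  rewrite -{l}kl in yz *.
  have IH w := IHn w y z yz; have hyz := height_edge n y z yz.
  case: (unliftP ord0 i) => [i'|] ->; case: (unliftP ord0 k) => [k'|] ->.
  + have [->|kl] := eqVneq i' k'; first by rewrite !dist_copy.
    rewrite !distSS //; lia.
  + by rewrite !distS0; have := IH (att i'); lia.
  + by rewrite !dist0S; have := IH x; lia.
  + by rewrite !dist00.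
- move=> /new_edgeP[j [-> ->] [-> ->]].
  case: (unliftP ord0 i) => [i'|] ->; last first.
    by rewrite dist00 dist0S height_center; lia.
  have [->|kl] := eqVneq i' j; first by rewrite dist_copy distS0 dist_center distxx; lia.
  rewrite distSS // distS0; lia.
- move=> /new_edgeP[j [-> ->] [-> ->]].
  case: (unliftP ord0 i) => [i'|] ->; last first.
    rewrite dist00 dist0S height_center; lia.
  have [->|kl] := eqVneq i' j; first by rewrite dist_copy distS0 dist_center distxx; lia.
  rewrite distSS // distS0 height_center; lia.
Qed.

(** * Walks in the finite trees *)

Lemma dist_walk n (x : tvert n) p : path (@tedge delta C n) x p -> dist x (last x p) <= size p.
Proof.
elim/last_ind: p => [|p y IHp]; first by rewrite distxx.
rewrite rcons_path last_rcons size_rcons => /andP[/IHp xp /dist_edge py].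
exact: leq_trans (py x) _.
Qed.

(** Go to the center of tau_j, cross the new edge, go on to the center of tau_0: two walks of length
    at most 2^n - 1 and one edge. *)
Lemma walk_center n (x : tvert n) :
  exists2 p, path (@tedge delta C n) x p /\ last x p = tcenter delta n & size p < 2 ^ n.
Proof.
elim: n x => [|n IHn] x; first by case: x; exists [::].
have lift_walk (i : 'I_(delta n.+1).+1) (z : tvert n) p : path (@tedge delta C n) z p ->
    path (@tedge delta C n.+1) (i, z) [seq ((i, t) : tvert n.+1) | t <- p].
  by move=> zp; apply: homo_path zp => a b; rewrite tedge_copy.
case: x => i x; case: (unliftP ord0 i) => [j|] ->; last first.
  have [p [xp lp] sp] := IHn x; exists [seq ((ord0, t) : tvert n.+1) | t <- p].
    by split; [exact: lift_walk|rewrite last_map lp].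
  by rewrite size_map (leq_trans sp) // leq_exp2l.
have [p [xp lp] sp] := IHn x; have [q [aq lq] sq] := IHn (att j).
exists ([seq ((lift ord0 j, t) : tvert n.+1) | t <- p] ++
        [seq ((ord0, t) : tvert n.+1) | t <- att j :: q]).
  split; last by rewrite last_cat /= last_map lq.
  rewrite cat_path lift_walk //= last_map lp lift_walk // andbT.
  by apply/or3P/Or32/new_edgeP; exists j.
rewrite size_cat !size_map expnS mul2n -addnn -addSn; exact: leq_add.
Qed.

Lemma walk_between n (x y : tvert n) :
  exists2 p, path (@tedge delta C n) x p /\ last x p = y & size p <= 2 * (2 ^ n).-1.
Proof.
have [p [xp lp] sp] := walk_center n x; have [q [yq lq] sq] := walk_center n y.
(* [rev (belast y q)] is the walk [q] run backwards, from the center to [y]. *)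
exists (p ++ rev (belast y q)); last by rewrite size_cat size_rev size_belast; lia.
split; last first.
  by case: q lq {yq sq} => [/= ->|z q _] /=; rewrite ?cats0 // rev_cons last_cat last_rcons.
rewrite cat_path xp lp -lq rev_path; apply: sub_path yq => a b /=.
by rewrite tedge_sym.
Qed.

(** * Counting vertices near the center and near a given vertex *)

Lemma card_pair (A B : finType) (P : pred (A * B)) :
  #|[pred y | P y]| = \sum_(i : A) #|[pred b | P (i, b)]|.
Proof.
rewrite -sum1_card; under [RHS]eq_bigr => i _ do rewrite -sum1_card.
by rewrite pair_big_dep /=; apply: eq_bigl => -[].
Qed.

(** This is phi. Radii are strict, so radius 0 gives the empty set, and truncated subtraction of
    radii takes care of copies out of reach. *)
Definition below n r := #|[pred y : tvert n | height y < r]|.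
Definition reach n (x : tvert n) r := #|[pred y : tvert n | dist x y < r]|.
Arguments reach {n}.

Lemma belowS n r :
  below n.+1 r = below n r + delta n.+1 * below n (r - 2 ^ n).
Proof.
rewrite /below card_pair big_ord_recl; congr (_ + _).
rewrite -[X in _ = X * _]card_ord -sum_nat_const; apply: eq_bigr => j _.
by apply: eq_card => y; rewrite !inE heightS; lia.
Qed.

Lemma below0 n : below n 0 = 0.
Proof. exact: eq_card0. Qed.

Lemma below_mono n r s : r <= s -> below n r <= below n s.
Proof. by move=> rs; apply/subset_leq_card/fintype.subsetP => y; rewrite !inE; lia. Qed.

Lemma below_max n r : below n r <= #|tvert n|.
Proof. exact: max_card. Qed.

Lemma below_small k n r : r <= 2 ^ n -> below (k + n) r = below n r.
Proof.
move=> rn; elim: k => // k IHk; rewrite belowS IHk (_ : r - _ = 0) ?below0 ?muln0 ?addn0 //.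
by apply/eqP; rewrite subn_eq0 (leq_trans rn) // leq_exp2l // leq_addl.
Qed.

Lemma card_tvertS n : #|tvert n.+1| = (delta n.+1).+1 * #|tvert n|.
Proof. by rewrite card_prod card_ord. Qed.

(** The smaller radius b stays inside tau_0. If a does too, two copies of T_n suffice. Otherwise, in
    one outer copy the part of height below a - 2^n is paired with b by induction, and every other
    copy counts at most fully. *)
Lemma below_add (delta_ge1 : forall n, 0 < n -> 0 < delta n) n a b :
  a + b <= 2 ^ n -> below n a + below n b <= #|tvert n|.
Proof.
elim: n a b => [|n IHn] a b.
  have cu : #|tvert 0| = 1 by rewrite card_unit.
  case: a => [|a]; first by rewrite below0 !add0n below_max.
  case: b => [|b]; first by rewrite below0 !addn0 below_max.
  by rewrite expn0; lia.
wlog ba : a b / b <= a.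
  by case: (leqP b a) => ba W abn; [|rewrite addnC]; apply: W => //; lia.
move=> abn; have bn : b - 2 ^ n = 0 by move: abn; rewrite expnS; lia.
rewrite !belowS bn below0 card_tvertS.
have d1 := delta_ge1 n.+1 isT.
have [an|na] := leqP a (2 ^ n).
  rewrite (_ : a - _ = 0) ?below0; last lia.
  by have := below_max n a; have := below_max n b; nia.
have := IHn (a - 2 ^ n) b; have := below_max n a; move: abn; rewrite expnS.
nia.
Qed.

Lemma reach_copy0 n (x : tvert n) r :
  reach ((ord0, x) : tvert n.+1) r
    = reach x r + \sum_(j < delta n.+1) below n (r - (dist x (att j)).+1).
Proof.
rewrite /reach card_pair big_ord_recl; congr (_ + _).
  by apply: eq_card => y; rewrite !inE dist00.
by apply: eq_bigr => j _; apply: eq_card => y; rewrite !inE dist0S; lia.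
Qed.

Lemma reach_copyS n (x : tvert n) i r :
  reach ((lift ord0 i, x) : tvert n.+1) r
    = reach x r + reach (att i) (r - (height x).+1)
      + \sum_(j < delta n.+1 | j != i)
          below n (r - (height x + dist (att i) (att j)).+2).
Proof.
rewrite /reach card_pair big_ord_recl (bigD1 i) // addnA; congr (_ + _); last first.
  by apply: eq_bigr => j ji; apply: eq_card => y; rewrite !inE distSS 1?eq_sym //; lia.
rewrite addnC; congr (_ + _).
  by apply: eq_card => y; rewrite !inE dist_copy.
by apply: eq_card => y; rewrite !inE distS0; lia.
Qed.

(** * Canonical copies of T_n inside T_(k+n) *)

Fixpoint core n k : tvert (k + n) -> tvert n :=
  if k is k'.+1 then fun x => core n k' x.2 else id.
(** The k outer coordinates of a vertex name its canonical copy of T_n. That copy contains the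
    center if they all vanish ([central]), and is apocentric if none does ([peripheral]). *)
Fixpoint same_copy n k : rel (tvert (k + n)) :=
  if k is k'.+1 then fun x y => (x.1 == y.1) && same_copy n k' x.2 y.2
  else fun _ _ => true.
Fixpoint central n k : pred (tvert (k + n)) :=
  if k is k'.+1 then fun x => (x.1 == ord0) && central n k' x.2 else fun=> true.
Fixpoint peripheral n k : pred (tvert (k + n)) :=
  if k is k'.+1 then fun x => (x.1 != ord0) && peripheral n k' x.2
  else fun=> true.

Section Copies.
Variable n : nat.
Local Notation core := (core n _).
Local Notation same_copy := (same_copy n _).
Local Notation central := (central n _).
Local Notation peripheral := (peripheral n _).

Lemma apocentric_core k (x : tvert (k + n)) :
  apocentric x = peripheral x && apocentric (core x).
Proof. by elim: k x => //= k IHk x; rewrite IHk andbA. Qed.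

Lemma height_core k (x : tvert (k + n)) : central x -> height x = height (core x).
Proof. by elim: k x => //= k IHk x /andP[-> /IHk]. Qed.

Lemma height_noncentral k (x : tvert (k + n)) : ~~ central x -> 2 ^ n <= height x.
Proof.
elim: k x => //= k IHk [i x] /=; case: eqP => [_ /= /IHk //|_ _].
by rewrite mul1n (leq_trans _ (leq_addr _ _)) // leq_exp2l // leq_addl.
Qed.

Lemma dist_core k (x y : tvert (k + n)) :
  same_copy x y -> dist x y = dist (core x) (core y).
Proof.
elim: k x y => // k IHk [i x] [j y] /andP[ij xy].
have {}ij : i = j := eqP ij.
by rewrite -ij [LHS](dist_copy _ i); apply: IHk.
Qed.

Lemma same_copy_peripheral k (x y : tvert (k + n)) :
  same_copy x y -> peripheral x = peripheral y.
Proof. by elim: k x y => //= k IHk x y /andP[/eqP-> /IHk->]. Qed.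

(** An apocentric copy has no children in T_(k+n), so a path from outside enters it at its center
    and still has 2^n - 1 edges to go to [a]. *)
Lemma dist_other_copy k (x a : tvert (k + n)) :
  apocentric a -> ~~ same_copy x a -> 2 ^ n <= dist x a.
Proof.
elim: k x a => // k IHk [i x] [j a] /andP[j0 apa]; rewrite negb_and => ijxa.
have hn : 2 ^ n <= 2 ^ (k + n) by rewrite leq_exp2l // leq_addl.
have ha := height_apocentric _ _ apa.
case: (unliftP ord0 j) j0 ijxa => [l|] ->; last by rewrite eqxx.
move=> _; case: (unliftP ord0 i) => [m|] -> ijxa; last first.
  by rewrite [dist _ _](@dist0S (k + n)) (leq_trans hn) // -ha ltnS leq_addl.
have [ml|ml] := eqVneq m l; last first.
  by rewrite [dist _ _](@distSS (k + n)) // (leq_trans hn) // -ha ltnS leqW // leq_addl.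
by rewrite ml [dist _ _](@dist_copy (k + n)) IHk //; move: ijxa; rewrite ml eqxx.
Qed.

Lemma reach_apocentric k (a : tvert (k + n)) r :
  apocentric a -> r <= 2 ^ n -> reach a r <= #|tvert n|.
Proof.
move=> + rn; elim: k a => [|k IHk]; first by move=> *; apply: max_card.
apply: (@tvertS_ind (k + n)) => // j a apa.
have {}apa : apocentric a := apa.
have ha := height_apocentric _ _ apa.
have hn : 2 ^ n <= 2 ^ (k + n) by rewrite leq_exp2l // leq_addl.
rewrite [reach _ _](@reach_copyS (k + n)) big1 => [|l _]; last first.
  by rewrite (_ : r - _ = 0) ?below0 //; lia.
have -> : r - (height a).+1 = 0 by lia.
by rewrite addn0 [X in _ + X]eq_card0 // addn0 IHk.
Qed.

(** Copies attached outside the copy of [x] are out of reach by [dist_other_copy]; in the others the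
    small radius stays within the central copy of T_n. *)
Lemma sum_below_attach k (x : tvert (k + n)) r s : r <= 2 ^ n ->
    (forall j, same_copy x (att j) -> r - dist x (att j) <= s) ->
  \sum_(j < delta (k + n).+1) below (k + n) (r - dist x (att j))
    <= #|[pred j | same_copy x (@attach delta C (k + n) j)]| * below n s.
Proof.
move=> rn rs; rewrite -sum_nat_const [leqRHS]big_mkcond; apply: leq_sum => j _.
rewrite inE; case: ifP => [xj|/negbT xj].
  by rewrite below_small ?below_mono ?rs // (leq_trans _ rn) // leq_subr.
have := dist_other_copy _ _ _ (attach_apocentric C j) xj => rd.
by rewrite (_ : r - _ = 0) ?below0 //; lia.
Qed.

(* A ball of radius less than 2 ^ n around x only meets the copy of T_n
   containing x, its children, its parent and its siblings. The children only
   appear once the copy has stopped being apocentric, the parent and the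
   siblings once it has stopped being central. *)
Lemma reach_le M k (x : tvert (k + n)) :
    (forall k (x : tvert (k + n)),
      #|[pred j | same_copy x (@attach delta C (k + n) j)]| <= M) ->
  reach x (2 ^ n) <= #|tvert n|
    + ~~ peripheral x * (M * below n (height (core x)))
    + ~~ central x * (#|tvert n| + M * below n (2 ^ n - (height (core x)).+2)).
Proof.
move=> branch; elim: k x => [|k IHk] x; first by rewrite !addn0 max_card.
move: x; apply: (@tvertS_ind (k + n)) => [x|j x]; last first.
  rewrite [reach _ _](@reach_copyS (k + n)) mul1n -[core _]/(core x) -[peripheral _]/(peripheral x).
  (* A non-central [x] has height at least 2^n, too much to get out into tau_0 through the
     center. *)
  have [cx|ncx] := boolP (central x); last first.
    have := height_noncentral _ _ ncx => hx.
    have -> : 2 ^ n - (height x).+1 = 0 by lia.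
    rewrite [X in _ + X + _]eq_card0 // big1 => [|l _]; last first.
      by rewrite (_ : _ - _ = 0) ?below0 //; lia.
    by rewrite !addn0; have := IHk x; rewrite ncx mul1n.
  have := IHk x; rewrite cx mul0n addn0 => IHx; rewrite -addnA leq_add //.
  apply: leq_add.
    by apply: reach_apocentric; [exact: attach_apocentric|rewrite leq_subr].
  rewrite -(height_core _ _ cx).
  apply: leq_trans (leq_mul (branch k (att j)) (leqnn _)).
  apply: leq_trans (sum_below_attach _ _ _ _ _ _); last first.
  - by move=> l _; apply: leq_subr.
  - by rewrite leq_subr.
  (* The count in [branch] includes [j] itself, which is not among the siblings. *)
  rewrite [leqRHS](bigID (fun l => l != j)) /=.
  rewrite (leq_trans _ (leq_addr _ _)) //; apply: leq_sum => l _.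
  by apply: below_mono; lia.
rewrite [reach _ _](@reach_copy0 (k + n)) mul1n -[core _]/(core x) -[central _]/(central x).
rewrite -addnA [_ * _ + _]addnC.
have := IHk x => IHx.
suff : \sum_(j < delta (k + n).+1) below (k + n) (2 ^ n - (dist x (att j)).+1)
    <= peripheral x * (M * below n (height (core x))).
  by move: IHx; case: (peripheral x); rewrite /= ?mul0n ?mul1n; lia.
apply: (@leq_trans (#|[pred j | same_copy x (@attach delta C (k + n) j)]|
    * below n (height (core x)))).
  (* The edge to the child is charged to the radius: 2^n - (d + 1) = (2^n - 1) - d. *)
  apply: leq_trans (sum_below_attach _ _ (2 ^ n).-1 _ (leq_pred _) _).
    by apply: leq_sum => j _; apply: below_mono; lia.
  (* The core of [att j] has height 2^n - 1, hence distance at least 2^n - 1 - h from [core x] of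
     height h, which leaves radius at most h. *)
  move=> j xj; rewrite (dist_core _ _ _ xj).
  have := attach_apocentric C j; rewrite apocentric_core => /andP[_ /height_apocentric].
  by have := height_le_dist _ (core x) (core (att j)); lia.
have [px|npx] := boolP (peripheral x); first by rewrite mul1n leq_mul.
rewrite eq_card0 // => j; rewrite !inE; apply: contraNF npx => xj.
rewrite (same_copy_peripheral _ _ _ xj).
by have := attach_apocentric C j; rewrite apocentric_core => /andP[].
Qed.

(** The copy of [x] and its parent account for the 2; [below_add] merges the M children with the M
    siblings, their radii being h and 2^n - 2 - h. *)
Lemma reach_bound M k (x : tvert (k + n)) :
    (forall n, 0 < n -> 0 < delta n) ->
    (forall k (x : tvert (k + n)),
      #|[pred j | same_copy x (@attach delta C (k + n) j)]| <= M) ->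
  reach x (2 ^ n) <= M.+2 * #|tvert n|.
Proof.
move=> delta_ge1 branch; apply: leq_trans (reach_le _ _ x branch) _.
have := height_lt _ (core x) => hx.
have : below n (height (core x)) + below n (2 ^ n - (height (core x)).+2)
    <= #|tvert n| by apply: below_add => //; lia.
by case: (peripheral x); case: (central x); rewrite /= ?mul0n ?mul1n; nia.
Qed.

(** * Bounding the number of child copies by maximal uniformity *)

Lemma canonical_copies_refl m : canonical_copies delta m m = [set [set: tvert m]].
Proof. by case: m => [//|m]; rewrite -[LHS]/(if m.+1 == m.+1 then _ else _) eqxx. Qed.

Lemma same_copy_canonical k (x : tvert (k + n)) :
  [set y | same_copy x y] \in canonical_copies delta n (k + n).
Proof.
elim: k x => [|k IHk] x.
  by rewrite canonical_copies_refl inE; apply/eqP/setP => y; rewrite !inE.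
case: x => i x; have nk : (n == (k + n).+1) = false by apply/eqP; lia.
rewrite -[canonical_copies _ _ _]/(if n == (k + n).+1 then _ else _) nk.
apply/bigcupP; exists i => //; apply/imsetP; exists [set y | same_copy x y].
  exact: IHk.
apply/setP => -[j y]; rewrite inE; apply/andP/imsetP => [[/eqP/= <- xy]|[z]].
  by exists y; rewrite ?inE.
by rewrite inE => xz [-> ->].
Qed.

Lemma branching_le M :
    (forall k, (\prod_(1 <= i < n.+1) (delta i)%:R / \prod_(1 <= i < (k + n).+1) (delta i)%:R
       * (delta (k + n).+1)%:R <= M%:R :> rat)%R) ->
  forall k (x : tvert (k + n)),
    #|[pred j | same_copy x (@attach delta C (k + n) j)]| <= M.
Proof.
move=> qM k x.
(* Uniformity speaks of apocentric copies; a single child [j] shows that the copy is apocentric. *)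
have [j xj|noj] := pickP [pred j | same_copy x (@attach delta C (k + n) j)]; last first.
  by rewrite eq_card0.
have apo : apocentric_set [set y | same_copy x y].
  by exists (att j); [rewrite inE|exact: attach_apocentric].
have := attach_uniform C (leq_addl k n) (same_copy_canonical _ x) apo.
case/andP=> _; rewrite -lez_nat => uE.
rewrite (eq_card (B := [set j | att j \in [set y | same_copy x y]])); last first.
  by move=> l; rewrite !inE.
by rewrite (le_trans uE) // ceil_le_int; apply: qM.
Qed.
End Copies.

(** * Vertex degrees in the finite trees *)

Lemma same_copy0 k (x y : tvert (k + 0)) : same_copy 0 k x y = (x == y).
Proof. by elim: k x y => [[] []|k IHk [i x] [j y]] //=; rewrite IHk. Qed.

Lemma card_apocentric n : #|[pred x : tvert n | apocentric x]| = \prod_(1 <= k < n.+1) delta k.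
Proof.
elim: n => [|n IHn]; first by rewrite big_nil card_unit.
rewrite big_nat_recr //= -IHn card_pair big_ord_recl eq_card0 ?add0n //.
rewrite mulnC -[X in X * _]card_ord -sum_nat_const; apply: eq_bigr => j _.
by apply: eq_card => x; rewrite !inE.
Qed.

(** Pigeonhole: the new edges end at the delta_1 ... delta_n apocentric vertices of tau_0. *)
Lemma attach_count_le n e :
    (forall x : tvert n, #|[pred j | att j == x]| <= e) ->
  delta n.+1 <= (\prod_(1 <= k < n.+1) delta k) * e.
Proof.
move=> xe; rewrite -[leqLHS]card_ord -sum1_card.
rewrite (partition_big (@attach delta C n) (@apocentric delta n)) => [|j _] /=; last first.
  exact: attach_apocentric.
rewrite -card_apocentric -sum_nat_const; apply: leq_sum => x _.
by rewrite sum1_card; apply: leq_trans (xe x); apply: eq_leq; apply: eq_card.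
Qed.

Definition deg n (x : tvert n) := #|[pred y | tedge C x y]|.
Arguments deg {n}.

Lemma deg_copy0 n (x : tvert n) :
  deg ((ord0, x) : tvert n.+1) = deg x + #|[pred j | att j == x]|.
Proof.
rewrite /deg card_pair big_ord_recl; congr (_ + _).
  by apply: eq_card => y; exact: tedge_copy.
rewrite -[RHS]sum1_card [RHS]big_mkcond; apply: eq_bigr => j _; rewrite inE.
case: ifP => xj.
  by rewrite -[RHS](card1 (tcenter delta n)); apply: eq_card => y; rewrite inE tedge_0S xj.
by rewrite eq_card0 // => y; rewrite inE tedge_0S xj.
Qed.

Lemma deg_copyS n i (x : tvert n) :
  deg ((lift ord0 i, x) : tvert n.+1) = deg x + (x == tcenter delta n).
Proof.
rewrite /deg card_pair big_ord_recl (bigD1 i) // big1 => [|j ji]; last first.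
  by apply: eq_card0 => y; rewrite inE tedge_SS // eq_sym.
rewrite [X in _ + X]addn0 addnC; congr (_ + _); first by apply: eq_card => y; exact: tedge_copy.
case: eqP => [->|/eqP/negPf xc].
  rewrite -[RHS](card1 (att i)); apply: eq_card => y.
  by rewrite !inE tedge_sym tedge_0S eqxx andbT eq_sym.
by apply: eq_card0 => y; rewrite inE tedge_sym tedge_0S xc andbF.
Qed.

Lemma deg_gt0 n (x : tvert n.+1) : (forall n, 0 < n -> 0 < delta n) -> 0 < deg x.
Proof.
move=> delta_ge1; elim: n x => [|n IHn]; apply: tvertS_ind => [x|i x].
- rewrite deg_copy0 addn_gt0; apply/orP; right.
  have d1 := delta_ge1 1 isT; apply/card_gt0P; exists (Ordinal d1).
  by rewrite inE; case: (att _); case: x.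
- by rewrite deg_copyS; case: x; rewrite addn1.
- by rewrite deg_copy0 addn_gt0 IHn.
- by rewrite deg_copyS addn_gt0 IHn.
Qed.

(* A vertex gets an edge towards its parent when it stops being central, and
   its edges towards its children when it stops being apocentric. *)
Lemma deg_le e n (x : tvert n) :
    (forall n (x : tvert n), #|[pred j | att j == x]| <= e) ->
  deg x <= (x != tcenter delta n) + ~~ apocentric x * e.
Proof.
move=> xe; elim: n x => [|n IHn]; first by move=> *; rewrite /deg eq_card0.
apply: tvertS_ind => [x|i x]; have := IHn x.
  have -> : ((ord0, x) != tcenter delta n.+1) = (x != tcenter delta n) by [].
  rewrite deg_copy0 [~~ _]/= mul1n => degx.
  apply: leq_trans (leq_add degx (leqnn _)) _; rewrite -addnA leq_add2l.
  have [apx|napx] := boolP (apocentric x); first by rewrite add0n xe.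
  rewrite mul1n eq_card0 ?addn0 // => j; rewrite !inE; apply: contraNF napx.
  by move=> /eqP<-; apply: attach_apocentric.
have -> : ((lift ord0 i, x) != tcenter delta n.+1) = true by [].
have -> : apocentric ((lift ord0 i, x) : tvert n.+1) = apocentric x by [].
by rewrite deg_copyS; case: eqP; case: (apocentric x) => /=; lia.
Qed.


(** Canonical copies of T_0 are single vertices, so this is [branching_le] at level 0, where the
    uniformity quotient is Delta(n+1). *)
Lemma attach_count_bound e :
    (forall n, (Delta delta n.+1 <= e%:R :> rat)%R) ->
  forall n (x : tvert n), #|[pred j | att j == x]| <= e.
Proof.
move=> De; have cnt := branching_le 0 e.
suff cnt0 k (x : tvert (k + 0)) : #|[pred j | @attach delta C (k + 0) j == x]| <= e.
  by move=> n; rewrite -[n]addn0; apply: cnt0.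
rewrite (eq_card (B := [pred j | same_copy 0 k x (@attach delta C (k + 0) j)])).
  by apply: cnt => i; rewrite big_geq // div1r mulrC; apply: De.
by move=> j; rewrite !inE same_copy0 eq_sym.
Qed.

(** Pigeonhole gives a vertex with more than e new edges. For n > 0 it already has an edge in
    T_n. *)
Lemma exists_deg_ge e n : (forall n, 0 < n -> 0 < delta n) ->
    (\prod_(1 <= k < n.+1) delta k) * e < delta n.+1 ->
  exists m (x : tvert m), e.+2 <= deg x.
Proof.
move=> delta_ge1; rewrite ltnNge => /negP ne.
have [x xe] : exists x : tvert n, e < #|[pred j | att j == x]|.
  apply: contrapT => noex; apply: ne; apply: attach_count_le => x.
  by rewrite leqNgt; apply/negP => xe; apply: noex; exists x.
case: n => [|n] in x xe {ne} *; last first.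
  by exists n.+2, (ord0, x); rewrite deg_copy0; have := deg_gt0 _ x delta_ge1; lia.
(* T_0 has no edge, so for n = 0 the extra one is the parent edge gained by the center of an outer
   copy of T_1 in T_2. *)
exists 2, (lift ord0 (Ordinal (delta_ge1 2 isT)), (ord0, x)).
rewrite deg_copyS deg_copy0.
have -> : (ord0, x) == tcenter delta 1 by case: x {xe}.
by rewrite addn1 ltnS (leq_trans xe) // leq_addl.
Qed.

Lemma card_tvert (R : comPzRingType) n :
  (#|tvert n|%:R = \prod_(1 <= k < n.+1) ((delta k)%:R + 1) :> R)%R.
Proof.
elim: n => [|n IHn]; first by rewrite card_unit big_nil.
by rewrite card_tvertS natrM big_nat_recr //= -IHn -natr1 mulrC.
Qed.

(** * Transfer to the limit tree *)

Section LimitTree.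
Variables (R : realType) (V : choiceType) (adj : rel V) (T : limit_tree C adj).

(** An infinite set would contain b + 1 distinct elements. Bounds are thus reduced to finite lists,
    which lie in a single T_n. *)
Lemma counting_le (A : set V) b :
  (forall s, uniq s -> (forall w, w \in s -> A w) -> size s <= b) ->
  (counting A <= (b%:R : R)%:E)%E.
Proof.
move=> sb; have fA : finite_set A.
  apply: contrapT => /(infinite_set_fset b.+1)[B BA]; rewrite leqNgt => /negP; apply.
  by rewrite ltnS sb ?finmap.fset_uniq // => w wB; apply: BA.
rewrite /counting asboolT // lee_fin ler_nat sb ?finmap.fset_uniq // => w wA.
by apply/set_mem; rewrite -(in_fset_set fA).
Qed.

Lemma counting_ge (A : set V) s : uniq s -> (forall w, w \in s -> A w) ->
  (((size s)%:R : R)%:E <= counting A)%E.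
Proof.
move=> us sA; rewrite /counting; case: asboolP => [fA|_]; last exact: leey.
rewrite lee_fin ler_nat uniq_leq_size // => w /sA Aw.
by rewrite [_ \in _]in_fset_set //; apply/mem_set.
Qed.

Lemma emb_lift n N : n <= N -> exists f : tvert n -> tvert N,
  (forall x, emb T x = emb T (f x)) /\ forall x y, tedge C (f x) (f y) = tedge C x y.
Proof.
move=> /subnK <-; elim: (N - n) => [|k [f [fe fa]]]; first by exists id.
exists (fun x => (emb_index T (k + n), f x)); split=> [x|x y].
  by rewrite fe emb_chain.
by rewrite -fa; apply: (@tedge_copy (k + n)).
Qed.

(** [emb_adj] provides an edge at some level m; both levels are compared in T_max(n,m), as
    inclusions are injective and keep edges and non-edges. *)
Lemma adj_emb n (x y : tvert n) : adj (emb T x) (emb T y) = tedge C x y.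
Proof.
apply/idP/idP => [/(emb_adj T)[m [a [b [xa yb ab]]]]|xy]; last first.
  by apply/(emb_adj T); exists n, x, y.
have [f [fe fa]] := emb_lift n _ (leq_maxl n m).
have [h [he ha]] := emb_lift m _ (leq_maxr n m).
move: xa yb; rewrite !fe !he => /emb_inj xa /emb_inj yb.
by rewrite -fa xa yb ha.
Qed.

Lemma emb_seq (s : seq V) : exists N, forall n, N <= n ->
  exists s' : seq (tvert n), s = [seq emb T x | x <- s'].
Proof.
elim: s => [|v s [N IHs]]; first by exists 0 => n _; exists [::].
have [m [x ->]] := emb_cover T v.
exists (maxn m N) => n; rewrite geq_max => /andP[mn /IHs[s' ->]].
by have [f [fe _]] := emb_lift m _ mn; exists (f x :: s'); rewrite /= -fe.
Qed.

(** Finitely many walks lie in a common T_n, where [dist_walk] applies to them. *)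
Lemma emb_ball (v : V) r (s : seq V) :
    (forall w, w \in s -> exists2 p, path adj v p /\ last v p = w & size p < r) ->
  exists N, forall n, N <= n -> exists (x : tvert n) (s' : seq (tvert n)),
    [/\ v = emb T x, s = [seq emb T y | y <- s'] & all (fun y => dist x y < r) s'].
Proof.
elim: s => [|w s IHs] sr.
  have [N vN] := emb_seq [:: v]; exists N => n /vN[[//|x s'] [-> _]].
  by exists x, [::].
have [p [vp pw] pr] := sr w (mem_head _ _).
have [N1 pN] := emb_seq p.
have [N2 sN] := IHs (fun u us => sr u (mem_behead (s := w :: s) us)).
exists (maxn N1 N2) => n; rewrite geq_max => /andP[/pN[q pq] /sN[x [s' [vx ss sd]]]].
exists x, (last x q :: s'); split=> //=; first by rewrite -pw pq vx last_map ss.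
rewrite sd andbT; apply: leq_ltn_trans (dist_walk _ _ _ _) _.
  move: vp; rewrite vx pq path_map; apply: sub_path => a b /=.
  by rewrite adj_emb.
by move: pr; rewrite pq size_map.
Qed.

Lemma gball_walk v w (r : R) n : (r < 2 ^+ n)%R -> gball adj v r w ->
  exists2 p, path adj v p /\ last v p = w & size p < 2 ^ n.
Proof.
move=> rn vw; have : (gdist R adj v w < (2 ^+ n)%:E)%E.
  by apply: le_lt_trans vw _; rewrite lte_fin.
case/ereal_inf_lt => _ [p /= vp <-]; rewrite lte_fin -natrX ltr_nat => pn.
by exists p.
Qed.

Lemma ball_size_le M n v (r : R) :
    (forall n, 0 < n -> 0 < delta n) ->
    (forall k (x : tvert (k + n)),
      #|[pred j | same_copy n _ x (@attach delta C (k + n) j)]| <= M) ->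
    (r < 2 ^+ n)%R ->
  (ball_size adj v r <= ((M.+2 * #|tvert n|)%:R : R)%:E)%E.
Proof.
move=> delta_ge1 branch rn; apply: counting_le => s us sv.
have [N sN] := emb_ball v (2 ^ n) s (fun w ws => gball_walk _ _ _ _ rn (sv w ws)).
(* Level N + n has the form k + n required by [reach_bound]. *)
have [x [s' [_ ss sd]]] := sN (N + n) (leq_addr _ _).
apply: leq_trans (reach_bound _ _ _ x delta_ge1 branch).
move: us; rewrite ss size_map => us.
rewrite -(card_uniqP (map_uniq us)); apply/subset_leq_card/fintype.subsetP => y ys.
by rewrite inE (allP sd).
Qed.

Lemma ball_size_lt1 v (r : R) : (r < 1)%R -> (ball_size adj v r <= 1%:E :> \bar R)%E.
Proof.
move=> r1; apply: (@counting_le _ 1) => s us sv.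
apply: (@uniq_leq_size _ _ [:: v]) => // w ws.
have [[|u p] [_ <-] //] := gball_walk _ _ _ 0 (r1 : r < 2 ^+ 0)%R (sv w ws).
by rewrite mem_head.
Qed.

(** If v first shows up in T_N with n <= N, its canonical copy of T_n serves; otherwise T_n itself
    does. *)
Lemma copy_around n (v : V) : exists2 f : tvert n -> V, injective f &
  (exists x, f x = v) /\ forall x y, tedge C x y -> adj (f x) (f y).
Proof.
have [N [x vx]] := emb_cover T v; have [nN|Nn] := leqP n N; last first.
  have [f [fe _]] := emb_lift _ _ (ltnW Nn); exists (emb T (n := n)) => [|].
    exact: emb_inj.
  by split=> [|a b]; [exists (f x); rewrite -fe|rewrite adj_emb].
have lift : forall k (x : tvert (k + n)), exists2 f : tvert n -> tvert (k + n),
    injective f & (exists y, f y = x) /\ forall a b, tedge C (f a) (f b) = tedge C a b.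
  elim=> [|k IHk] y; first by exists id => //; split=> //; exists y.
  case: y => i y; have [f finj [[z fz] fa]] := IHk y.
  exists (fun a => (i, f a)) => [a b [/finj//]|]; split=> [|a b].
    by exists z; rewrite fz.
  by rewrite -fa; apply: (@tedge_copy (k + n)).
move: x vx; rewrite -(subnK nN) => x vx; have [f finj [[y fy] fa]] := lift _ x.
exists (fun a => emb T (f a)) => [a b /emb_inj/finj//|]; split=> [|a b].
  by exists y; rewrite fy.
by rewrite adj_emb fa.
Qed.

Lemma ball_size_ge n v (r : R) : ((2 * (2 ^ n).-1)%:R <= r)%R ->
  ((#|tvert n|%:R : R)%:E <= ball_size adj v r)%E.
Proof.
move=> nr; have [f finj [[x fx] fa]] := copy_around n v.
rewrite cardE -(size_map f); apply: counting_ge.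
  by rewrite (map_inj_uniq finj) enum_uniq.
move=> _ /mapP[y _ ->]; have [p [xp py] ps] := walk_between n x y.
have pr : ((size p)%:R <= r)%R by rewrite (le_trans _ nr) // ler_nat.
apply: (@le_trans _ _ ((size p)%:R%:E)%E); last by rewrite lee_fin.
apply: ereal_inf_lbound; exists [seq f z | z <- p]; last by rewrite size_map.
by split; rewrite -fx; [exact: homo_path xp|rewrite last_map py].
Qed.

Lemma degree_emb_ge n (x : tvert n) : ((deg x)%:R%:E <= degree R adj (emb T x))%E.
Proof.
rewrite /deg cardE -(size_map (emb T (n := n))); apply: counting_ge.
  by rewrite (map_inj_uniq (@emb_inj _ _ _ _ T n)) enum_uniq.
by move=> _ /mapP[y + ->]; rewrite mem_enum inE /= adj_emb.
Qed.

Lemma degree_le e v : (forall n (x : tvert n), deg x <= e) ->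
  (degree R adj v <= e%:R%:E)%E.
Proof.
move=> xe; apply: counting_le => s us sv.
have [N /(_ _ (leqnn _))[[|x s'] // [vx ss]]] := emb_seq (v :: s).
apply: leq_trans (xe N x); move: us; rewrite ss size_map => us.
rewrite -(card_uniqP (map_uniq us)); apply/subset_leq_card/fintype.subsetP => y ys.
by rewrite inE -adj_emb -vx; apply: sv; rewrite ss map_f.
Qed.

End LimitTree.
End FiniteTrees.

(** * Suprema of ceilings, and dyadic scales *)

Lemma ereal_sup_int (R : realType) (I : Type) (S : set I) (f : I -> int) :
    (exists i, S i) ->
    (ereal_sup [set ((f i)%:~R : R)%:E | i in S]%classic < +oo)%E ->
  exists2 i, S i & ereal_sup [set ((f i)%:~R : R)%:E | i in S]%classic = (f i)%:~R%:E
    /\ forall j, S j -> f j <= f i.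
Proof.
set F := [set _ | _ in S]%classic => -[i0 Si0] supF.
have ub j : S j -> (((f j)%:~R : R)%:E <= ereal_sup F)%E.
  by move=> Sj; apply: ereal_sup_ubound; exists j.
have fin : ereal_sup F \is a fin_num.
  by rewrite fin_numE -ltey supF andbT gt_eqF // (lt_le_trans _ (ub _ Si0)) // ltNyr.
(* A value exceeding the supremum minus 1 dominates all the others, since the values are
   integers. *)
have [_ [i Si <-]] := ub_ereal_sup_adherent (ltr01 : 0 < 1 :> R) fin.
rewrite -(fineK fin) -EFinB lte_fin ltrBlDr => supi.
have le_i j : S j -> f j <= f i.
  move=> /ub; rewrite -(fineK fin) lee_fin => /le_lt_trans/(_ supi).
  by rewrite -intrD1 ltr_int ltzD1.
exists i => //; split=> //; rewrite fineK //; apply: le_anti.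
by rewrite ub // andbT; apply: ge_ereal_sup => _ [j /le_i ji <-]; rewrite lee_fin ler_int.
Qed.

Lemma exists_expn2 (R : realType) (x : R) : 1 <= x ->
  exists n, 2 ^+ n <= x < 2 ^+ n.+1.
Proof.
move=> x1; have [n] : exists n, x < 2 ^+ n.
  exists (Num.bound x); apply: lt_le_trans (archi_boundP _) _; first lra.
  by rewrite -natrX ler_nat ltnW // ltn_expl.
elim: n => [|n IHn xn]; first by rewrite expr0; lra.
by have [xn'|] := ltP x (2 ^+ n); [exact: IHn|exists n; apply/andP].
Qed.

Lemma Delta_gt0 delta n : (forall n, (1 <= n)%N -> (1 <= delta n)%N) ->
  (1 <= n)%N -> 0 < Delta delta n.
Proof.
move=> delta_ge1 n1; rewrite divr_gt0 ?ltr0n ?delta_ge1 //.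
rewrite big_seq_cond prodr_gt0 // => k; rewrite andbT mem_index_iota ltr0n.
by case/andP=> /delta_ge1.
Qed.

(** The supremum is an attained positive integer e + 1. The index attaining it has Delta > e and
    later yields a vertex of maximum degree. *)
Lemma Delta_bar_fin (R : realType) delta :
    (forall n, (1 <= n)%N -> (1 <= delta n)%N) -> (Delta_bar R delta < +oo)%E ->
  exists e n, [/\ Delta_bar R delta = (e.+2%:R)%:E,
    forall n, Delta delta n.+1 <= e.+1%:R & e%:R < Delta delta n.+1].
Proof.
move=> delta_ge1; rewrite /Delta_bar => fin.
have [|[//|n] _ [-> supn]] := @ereal_sup_int R _ [set n | (1 <= n)%N]%classic
  (fun n => Num.ceil (Delta delta n)) (ex_intro _ 1%N isT).
  by move: fin; case: (ereal_sup _) => [r _|//|_]; rewrite ?ltry ?ltNyr.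
have : 0 < Num.ceil (Delta delta n.+1) by rewrite ceil_gt0 Delta_gt0.
case E : (Num.ceil _) => [[|e]|] // _; exists e, n; split=> [|m|].
- by rewrite -EFinD natr1.
- by rewrite -(ceil_le_int _ e.+1) -E supn.
- by rewrite ltNge -(ceil_le_int _ e) E lez_nat ltnn.
Qed.

Lemma Delta_bar_ltey (R : realType) delta (b : nat) :
  (forall n, Delta delta n.+1 <= b%:R) -> (Delta_bar R delta < +oo)%E.
Proof.
move=> Db; apply: (@le_lt_trans _ _ ((b%:R + 1)%:E)); last exact: ltry.
rewrite EFinD; apply: leeD => //; apply: ge_ereal_sup => _ [[//|n] _ <-].
by rewrite lee_fin -[b%:R]/((b%:Z)%:~R) ler_int ceil_le_int; apply: Db.
Qed.

Lemma Gamma_fin (R : realType) delta :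
    (forall n, (1 <= n)%N -> (1 <= delta n)%N) -> (Gamma R delta < +oo)%E ->
  exists2 e, Gamma R delta = (e.+1%:R)%:E &
    forall n m, (n <= m)%N -> Delta delta m.+1 <= e.+1%:R * Delta delta n.+1.
Proof.
move=> delta_ge1 fin.
have [|[m n] /= [n1 nm] [E supn]] := @ereal_sup_int R _
    [set p : nat * nat | (1 <= p.2)%N /\ (p.2 <= p.1)%N]%classic
    (fun p => Num.ceil (Delta delta p.1 / Delta delta p.2))
    (ex_intro _ (1, 1)%N (conj isT isT)).
  exact: fin.
have : 0 < Num.ceil (Delta delta m / Delta delta n).
  by rewrite ceil_gt0 divr_gt0 ?Delta_gt0 // (leq_trans n1).
move: E supn; case: (Num.ceil _) => [[|e]|] // E supn _; exists e => // i j ij.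
rewrite -ler_pdivrMr ?Delta_gt0 // -(ceil_le_int _ e.+1).
by apply: (supn (j.+1, i.+1)).
Qed.

Theorem theorem3p4 (R : realType) (g : R -> R) (c : R) (delta : nat -> nat)
  (g_ge0 : forall x, 0 <= x -> 0 <= g x)
  (g_incr : forall x y, 0 <= x -> x < y -> g x < g y)
  (g_superadd : forall x y, 0 <= x -> 0 <= y -> g x + g y <= g (x + y))
  (c_le : c <= 1 / 2)
  (delta_ge1 : forall n, (1 <= n)%N -> (1 <= delta n)%N)
  (delta_g : forall n,
     (1 - c) * g (2 ^+ n) < \prod_(1 <= k < n.+1) ((delta k)%:R + 1)
       < (1 + c) * g (2 ^+ n))
  (C : tree_construction delta) (V : choiceType) (adj : rel V)
  (T : limit_tree C adj) :
  (forall (v : V) (r : R), 0 <= r ->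
   [/\ (* (i) *)
       ((((1 - c) * g (r / 4))%:E <= ball_size adj v r)%E /\
        1 / 2 * g (r / 4) <= (1 - c) * g (r / 4)),
       (* (ii) *)
       ((Delta_bar R delta < +oo)%E ->
        let D := fine (Delta_bar R delta) in
        [/\ is_max_degree adj (Delta_bar R delta),
            1 / 2 <= r ->
              (ball_size adj v r
                 <= (2 * D * (1 + c) ^+ 2 * g (2 * r) ^+ 2)%:E)%E
          & 2 * D * (1 + c) ^+ 2 * g (2 * r) ^+ 2
              <= 9 / 2 * D * g (2 * r) ^+ 2])
     & (* (iii) *)
       ((Gamma R delta < +oo)%E ->
        let G := fine (Gamma R delta) in
        [/\ (Delta_bar R delta < +oo)%E,
            1 / 4 <= r ->
              (ball_size adj v r
                 <= (2 * (1 + c) * (G * g (4 * r) - (G - 1) * g (2 * r)))%:E)%E,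
            2 * (1 + c) * (G * g (4 * r) - (G - 1) * g (2 * r))
              <= 3 * (G * g (4 * r) - (G - 1) * g (2 * r))
          & 3 * (G * g (4 * r) - (G - 1) * g (2 * r)) <= 3 * G * g (4 * r)])])
  /\ ((Gamma R delta < +oo)%E -> uniform_growth adj g).
Proof.
have g1_gt0 n : 0 < g (2 ^+ n).
  by apply: le_lt_trans (g_ge0 _ (lexx 0)) (g_incr _ _ (lexx 0) (exprn_gt0 n (ltr0Sn R 1))).
have g_le x y : 0 <= x -> x <= y -> g x <= g y.
  by move=> x0; rewrite le_eqVlt => /orP[/eqP->//|xy]; rewrite ltW ?g_incr.
(* The two bounds for n = 0 are compatible only if c > 0. *)
have c_gt0 : 0 < c.
  by have /andP[l u] := delta_g 0; have := lt_trans l u; have := g1_gt0 0; nra.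
have K_gt n : (1 - c) * g (2 ^+ n) < #|tvert delta n|%:R.
  by rewrite card_tvert; case/andP: (delta_g n).
have K_lt n : #|tvert delta n|%:R < (1 + c) * g (2 ^+ n).
  by rewrite card_tvert; case/andP: (delta_g n).
pose P n := (\prod_(1 <= k < n.+1) delta k)%N.
have P_gt0 n : (0 < P n)%N.
  by rewrite /P big_seq_cond prodn_cond_gt0 // => k; rewrite andbT mem_index_iota => /andP[/delta_ge1].
have PK n : (P n <= #|tvert delta n|)%N.
  by rewrite /P -card_apocentric max_card.
have DeltaP n : Delta delta n.+1 * (P n)%:R = (delta n.+1)%:R.
  by rewrite /Delta -natr_prod mulfVK // pnatr_eq0 -lt0n P_gt0.
(* In T_(k+n+1) the uniformity quotient for copies of T_n is [P n] times Delta(k+n+1). *)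
have branch M n : (forall k, (P n)%:R * Delta delta (k + n).+1 <= M%:R) ->
    forall k (x : tvert delta (k + n)),
      (#|[pred j | same_copy delta n _ x (@attach delta C (k + n) j)]| <= M)%N.
  by move=> PM; apply: branching_le => k; rewrite -natr_prod mulrAC -mulrA PM.
have lower (v : V) r : 0 <= r -> (((1 - c) * g (r / 4))%:E <= ball_size adj v r)%E.
  move=> r0; have [n nr rn] : exists2 n, (2 * (2 ^ n).-1)%:R <= r & r / 4 <= 2 ^+ n.
    have [r4|r4] := leP (r / 4) 1; first by exists 0%N.
    have [n /andP[nr rn]] := exists_expn2 _ _ (ltW r4).
    (* From 2^n <= r/4 < 2^(n+1), level n + 1 fits: 2 (2^(n+1) - 1) <= 4 * 2^n <= r. *)
    exists n.+1; last exact: ltW.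
    apply: (@le_trans _ _ ((4 * 2 ^ n)%:R)); first by rewrite ler_nat expnS; lia.
    by rewrite natrM natrX; lra.
  apply: le_trans (ball_size_ge _ _ _ _ _ T _ v _ nr); rewrite lee_fin.
  apply: le_trans (ltW (K_gt n)); rewrite ler_wpM2l //; first lra.
  by apply: g_le => //; lra.
have half_le r : 0 <= r -> 1 / 2 * g (r / 4) <= (1 - c) * g (r / 4).
  by move=> r0; rewrite ler_wpM2r ?g_ge0 ?divr_ge0 //; lra.
have upper2 (v : V) r e : (forall n, Delta delta n.+1 <= e.+1%:R) -> 1 / 2 <= r ->
    (ball_size adj v r <= (2 * e.+2%:R * (1 + c) ^+ 2 * g (2 * r) ^+ 2)%:E)%E.
  (* With 2^n <= 2r < 2^(n+1) the radius is below 2^n, while g(2^n) <= g(2r). *)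
  move=> De r2; have [n /andP[nr rn]] := exists_expn2 _ (2 * r) ltac:(lra).
  have rn' : r < 2 ^+ n by move: rn; rewrite exprS; lra.
  apply: le_trans (ball_size_le _ _ _ _ _ T (P n * e.+1) n v r delta_ge1 _ rn') _.
    apply: branch => k; rewrite natrM ler_wpM2l ?ler0n //; exact: De.
  rewrite lee_fin; set K := #|_|; have PKn : (P n <= K)%N := PK n.
  (* Since 1 <= [P n] <= K, the factor [P n] (e+1) + 2 is at most 2 (e+2) K. *)
  apply: (@le_trans _ _ ((2 * e.+2 * (K * K))%:R)).
    by rewrite ler_nat; have := P_gt0 n; nia.
  have -> : 2 * e.+2%:R * (1 + c) ^+ 2 * g (2 * r) ^+ 2
      = 2 * (e.+2%:R * ((1 + c) * g (2 * r) * ((1 + c) * g (2 * r)))) by ring.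
  rewrite !natrM -mulrA.
  have gn : K%:R <= (1 + c) * g (2 * r).
    apply: (le_trans (ltW (K_lt n))); rewrite ler_wpM2l //; first lra.
    by apply: g_le; rewrite ?exprn_ge0.
  by rewrite !ler_wpM2l ?ler0n // ler_pM ?ler0n.
have bracket_ge0 r (G : R) : 0 <= r -> 1 <= G -> 0 <= G * g (4 * r) - (G - 1) * g (2 * r).
  move=> r0 G1; have : g (2 * r) <= g (4 * r) by apply: g_le; lra.
  by have : 0 <= g (2 * r) by [apply: g_ge0; lra]; nra.
have upper3 (v : V) r e : (forall n m, (n <= m)%N -> Delta delta m.+1 <= e.+1%:R * Delta delta n.+1) ->
    1 / 4 <= r ->
    (ball_size adj v r
      <= (2 * (1 + c) * (e.+1%:R * g (4 * r) - (e.+1%:R - 1) * g (2 * r)))%:E)%E.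
  have E1 : e.+1%:R = e%:R + 1 :> R by rewrite natr1.
  have E2 : e.+2%:R = e%:R + 1 + 1 :> R by rewrite !natr1.
  (* Scale 0 means r < 1/2: the ball is one vertex, and 1 < (1 + c) g(1). Scale n + 1 gives r < 2^n
     and g(2^(n+1)) <= g(4r). *)
  move=> De r4; have [[|n] /andP[nr rn]] := exists_expn2 _ (4 * r) ltac:(lra).
    apply: le_trans (ball_size_lt1 _ _ _ _ r _) _; first by move: rn; lra.
    rewrite lee_fin.
    have K0 : 1 < (1 + c) * g 1.
      by have := K_lt 0; rewrite card_unit.
    have g14 : g 1 <= g (4 * r) by apply: g_le => //; lra.
    have g24 : g (2 * r) <= g (4 * r) by apply: g_le; lra.
    have eg : 0 <= e%:R * (g (4 * r) - g (2 * r)) by rewrite mulr_ge0 ?ler0n ?subr_ge0.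
    have : g (4 * r) <= e.+1%:R * g (4 * r) - (e.+1%:R - 1) * g (2 * r).
      by rewrite E1; lra.
    by nra.
  move: nr rn; rewrite !exprS => nr rn; have rn' : r < 2 ^+ n by lra.
  (* Here [P n] Delta(k+n+1) <= (e+1) [P n] Delta(n+1) = (e+1) delta_(n+1). *)
  apply: le_trans (ball_size_le _ _ _ _ _ T (e.+1 * delta n.+1) n v r delta_ge1 _ rn') _.
    apply: branch => k; rewrite natrM -DeltaP [leRHS]mulrA [leRHS]mulrC.
    by rewrite ler_wpM2l ?ler0n // De // leq_addl.
  rewrite lee_fin; apply: (@le_trans _ _ ((e.+2 * #|tvert delta n.+1|)%:R)).
    by rewrite ler_nat card_tvertS mulnA leq_mul2r; apply/orP; right; nia.
  have : g (2 * r) + g (2 * r) <= g (4 * r).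
    by apply: le_trans (g_superadd _ _ _ _) _; rewrite ?g_le //; lra.
  have : g (2 ^+ n.+1) <= g (4 * r).
    by apply: g_le; rewrite ?exprS //; have : 0 < 2 ^+ n :> R by rewrite exprn_gt0; lra.
  rewrite natrM; have := K_lt n.+1; have := g1_gt0 n.+1.
  set K := _%:R; set G := g (2 ^+ _); move=> G0 KG G4 g24.
  have eg : 0 <= e%:R * (g (4 * r) - (g (2 * r) + g (2 * r))) by rewrite mulr_ge0 ?ler0n ?subr_ge0.
  have eG : e.+2%:R * G <= e.+2%:R * g (4 * r) by rewrite ler_wpM2l ?ler0n.
  (* As g(2r) <= g(4r)/2, the right-hand side is at least (2(e+1) - e) g(4r) = (e+2) g(4r). *)
  have X : e.+2%:R * G <= 2 * (e.+1%:R * g (4 * r) - (e.+1%:R - 1) * g (2 * r)).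
    by apply: le_trans eG _; rewrite E1 E2; lra.
  apply: (@le_trans _ _ (e.+2%:R * ((1 + c) * G))); first by rewrite ler_wpM2l ?ler0n ?ltW.
  by rewrite mulrCA -mulrA [leRHS]mulrCA ler_wpM2l //; lra.
split; last first.
  move=> /(Gamma_fin _ _ delta_ge1)[e _ De].
  (* The constants come from (i) and from the last bound 3 Gamma g(4r) of (iii). *)
  exists (1 / 4), (1 / 2), 4, (3 * e.+1%:R); split; [lra|lra|lra| |].
    by rewrite mulr_gt0 ?ltr0n.
  move=> v r r0; split.
    apply: le_trans (lower v r r0); rewrite lee_fin.
    by rewrite (_ : 1 / 4 * r = r / 4) ?half_le //; lra.
  move=> r1; apply: le_trans (upper3 v r e De _) _; first lra.
  rewrite lee_fin.
  have e1 : 1 <= e.+1%:R :> R by rewrite ler1n.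
  have := bracket_ge0 r _ r0 e1.
  have : 0 <= g (2 * r) by [apply: g_ge0; lra].
  nra.
move=> v r r0; split; first by split; [exact: lower|exact: half_le].
  move=> /(Delta_bar_fin _ _ delta_ge1)[e [n [-> De en]]]; split=> [|r2|].
  - split=> [w|].
      apply: degree_le T _ _ _ => m x.
      apply: leq_trans (deg_le _ _ _ _ _ (attach_count_bound _ _ _ De)) _.
      by case: (x == _); case: apocentric => /=; lia.
    have [|m [x dx]] := exists_deg_ge _ C e n delta_ge1.
      by rewrite -(ltr_nat rat) natrM -DeltaP mulrC ltr_pM2r ?ltr0n ?P_gt0.
    exists (emb T x); apply: le_anti; apply/andP; split.
      apply: degree_le T _ _ _ => k y.
      apply: leq_trans (deg_le _ _ _ _ _ (attach_count_bound _ _ _ De)) _.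
      by case: (y == _); case: apocentric => /=; lia.
    by apply: le_trans (degree_emb_ge _ _ _ _ _ T _ x); rewrite lee_fin ler_nat.
  - exact: upper2.
  - rewrite /= ; have := ler0n R e.+2; have := sqr_ge0 (g (2 * r)).
    have : (1 + c) ^+ 2 <= 9 / 4 by nra.
    move=> c2 g2 e2.
    have := mulr_ge0 e2 g2 => eg.
    by have := ler_wpM2l eg c2; lra.
move=> /(Gamma_fin _ _ delta_ge1)[e -> De].
have e1 : 1 <= e.+1%:R :> R by rewrite ler1n.
have br := bracket_ge0 r _ r0 e1.
have g2 : 0 <= g (2 * r) by apply: g_ge0; lra.
split=> [|r4||] /=.
(* Every Delta(n+1) is at most Gamma times Delta(1) = delta_1. *)
- apply: (@Delta_bar_ltey _ _ (e.+1 * delta 1)) => n.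
  by rewrite natrM -DeltaP /P big_geq // mulr1 De.
- exact: upper3.
- nra.
- nra.
Qed.
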